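(* Let $v \geq 2$ be an integer and let $\alpha = (\alpha_1, \ldots, \alpha_v) \in \mathbb{R}^v$ be a vector such that $$\sum_{j \in C} \alpha_j \neq 0 \quad \text{for every nonempty proper subset } C \subsetneq \{1, \ldots, v\}, \qquad \text{and} \qquad \sum_{j=1}^v \alpha_j = 0.$$ Then there exists a constant $c(\alpha) > 0$, depending only on $\alpha$, such that for every constant $K > 0$ there is a set $E = E(K,\alpha) \subseteq [0,1]$ of Hausdorff dimension $c(\alpha)$ with the following property. The set $E$ does not contain any nontrivial solution of the equation $$f(x_1, \ldots, x_v) = 0, \qquad x_1, \ldots, x_v \in E \text{ not all identical},$$ for any $C^2$ function $f : [0,1]^v \to \mathbb{R}$ of the form $$f(x_1, \ldots, x_v) = \sum_{j=1}^v \alpha_j x_j + G(x_1, \ldots, x_v), \qquad \text{where } |G(x)| \leq K \sum_{j=2}^v (x_j - x_1)^2 .$$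
   Context: The set $E$ depends on $K$ and $\alpha$ only; it is the same for all functions $f$ of the stated form with the given $K$ and $\alpha$. The bound on $G$ is required at every $x = (x_1,\ldots,x_v) \in [0,1]^v$. *)

(* Defs.v *)
From HB Require Import structures.
From mathcomp Require Import all_boot all_order all_algebra.
From mathcomp Require Import all_classical all_reals all_analysis.

Set Implicit Arguments.
Unset Strict Implicit.
Unset Printing Implicit Defensive.

Import Order.TTheory GRing.Theory Num.Theory.
Import numFieldNormedType.Exports.

Local Open Scope classical_set_scope.
Local Open Scope ring_scope.

(* diam set0 = -oo; only the value on nonempty sets enters hausdorff_gauge. *)
Definition diam (R : realType) (A : set R) : \bar R :=
  ereal_sup [set `|p.1 - p.2|%:E | p in A `*` A].

(* The test for set0 makes the empty set cost 0 also when s = 0, so that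
   finite covers are those padded with set0; a point costs 0 `^ 0 = 1 then. *)
Definition hausdorff_gauge (R : realType) (s : R) (A : set R) : \bar R :=
  if A == set0 then 0%E else (diam A `^ s)%E.

Definition hausdorff_premeasure (R : realType) (s delta : R) (E : set R) :
    \bar R :=
  ereal_inf [set (\sum_(0 <= k <oo) hausdorff_gauge s (F k))%E |
    F in [set F : (set R)^nat |
      E `<=` \bigcup_k F k /\ forall k, (diam (F k) <= delta%:E)%E]].

Definition hausdorff_measure (R : realType) (s : R) (E : set R) : \bar R :=
  ereal_sup [set hausdorff_premeasure s delta E |
    delta in [set delta : R | 0 < delta]].

Definition hausdorff_dim (R : realType) (E : set R) : \bar R :=
  ereal_inf [set s%:E |
    s in [set s : R | 0 <= s /\ hausdorff_measure s E = 0%E]].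

Definition unit_cube (R : realType) (v : nat) : set 'rV[R]_v :=
  [set x | forall j, 0 <= x ord0 j <= 1].

Arguments unit_cube : clear implicits.

(* f is of class C^k on U, for U open: all the iterated partial derivatives of
   order at most k exist and are continuous at every point of U. *)
Fixpoint Ck_open (R : realType) (v k : nat) (U : set 'rV[R]_v)
    (f : 'rV[R]_v -> R) : Prop :=
  (forall x, U x -> {for x, continuous f}) /\
  if k is k'.+1 then
    forall i : 'I_v,
      (forall x, U x -> derivable f x (delta_mx ord0 i)) /\
      Ck_open k' U ('D_(delta_mx ord0 i) f)
  else True.

(* On a set that need not be open, such as the closed cube, f is of class C^k
   when it is the restriction of a C^k function on an open neighbourhood; the
   values of f outside D are irrelevant. *)
Definition Ck_on (R : realType) (v k : nat) (D : set 'rV[R]_v)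
    (f : 'rV[R]_v -> R) : Prop :=
  exists U : set 'rV[R]_v, exists g : 'rV[R]_v -> R,
    [/\ open U, D `<=` U, Ck_open k U g & forall x, D x -> g x = f x].

(* Main.v *)
(* E is a copy, scaled by delta, of the two-branch Cantor set of ratio r, of
   dimension c = ln 2 / ln (1 / r).  Given points x_j of E that are not all
   equal, let n be the first level at which their digits differ, and let C be
   the set of the indices j whose digit there is 1: it is nonempty and proper.
   As the alpha_j sum to 0, the common digits cancel and, up to
   O(delta r^(n+1)), the linear form is delta (1 - r) r^n times the sum of the
   alpha_j over C.  That sum is bounded away from 0, so a ratio r small in terms
   of alpha gives a lower bound of order delta r^n, whereas G is
   O(K (delta r^n)^2), which is smaller once delta is small in terms of K.
   Neither the scaling by delta nor, hence, K changes the dimension. *)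

Require Import Defs.
From mathcomp Require Import all_boot all_order all_algebra.
From mathcomp Require Import all_classical all_reals all_analysis.
From mathcomp Require Import ring lra.

Import Order.TTheory GRing.Theory Num.Theory.
Import numFieldNormedType.Exports.

Local Open Scope classical_set_scope.
Local Open Scope ring_scope.

Lemma near_expr_lt (R : realType) (q e : R) : 0 <= q < 1 -> 0 < e ->
  \forall n \near \oo, q ^+ n < e.
Proof.
move=> /andP[q0 q1] e0.
have : (fun n => q ^+ n) @ \oo --> (0 : R) by apply: cvg_expr; rewrite ger0_norm.
by move/cvgr_lt; apply.
Qed.

(** * Points coded by 0-1 sequences *)

Definition cantor_sum {R : realType} (r : R) (a : nat -> bool) (n : nat) : R :=
  \sum_(k < n) (a k)%:R * ((1 - r) * r ^+ k).

(** For r in [0, 1] the partial sums are nondecreasing and bounded, so the supremum is the sum of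
    the series. *)
Definition cantor_point {R : realType} (r : R) (a : nat -> bool) : R :=
  sup (range (cantor_sum r a)).

Section CantorPoint.
Context {R : realType} (r : R).
Implicit Types a b : nat -> bool.
Hypotheses (r_ge0 : 0 <= r) (r_le1 : r <= 1).

Lemma cantor_sumS a n :
  cantor_sum r a n.+1 = cantor_sum r a n + (a n)%:R * ((1 - r) * r ^+ n).
Proof. by rewrite /cantor_sum big_ord_recr. Qed.

(** The weights telescope: (1 - r) r^k = r^k - r^(k+1), so the digits from n to n + m - 1 add at
    most r^n - r^(n+m). *)
Lemma cantor_sum_itv a n m :
  cantor_sum r a n <= cantor_sum r a (n + m)
    <= cantor_sum r a n + r ^+ n - r ^+ (n + m).
Proof.
elim: m => [|m /andP[IH1 IH2]].
  by rewrite addn0 addrK lexx.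
rewrite addnS cantor_sumS exprS.
have h0 : 0 <= (1 - r) * r ^+ (n + m).
  by apply: mulr_ge0; rewrite ?subr_ge0 ?exprn_ge0.
by case: (a _); rewrite /= ?mul1r ?mul0r; apply/andP; split; lra.
Qed.

Lemma cantor_sum_le a n m : cantor_sum r a m <= cantor_sum r a n + r ^+ n.
Proof.
have [nm|mn] := leqP n m.
  have /andP[_] := cantor_sum_itv a n (m - n); rewrite subnKC//.
  have := exprn_ge0 m r_ge0; lra.
have /andP[h _] := cantor_sum_itv a m (n - m); rewrite subnKC// in h; last exact: ltnW.
have := exprn_ge0 n r_ge0; lra.
Qed.

Lemma cantor_point_itv a n :
  cantor_sum r a n <= cantor_point r a <= cantor_sum r a n + r ^+ n.
Proof.
have ne : range (cantor_sum r a) !=set0 by exists (cantor_sum r a 0); exists 0%N.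
have ub k : ubound (range (cantor_sum r a)) (cantor_sum r a k + r ^+ k).
  by move=> _ [m _ <-]; exact: cantor_sum_le.
apply/andP; split; last exact: ge_sup.
by apply: sup_upper_bound; [split=> //; exists (cantor_sum r a 0 + r ^+ 0)|exists n].
Qed.

Lemma eq_cantor_sum a b n :
  (forall k, (k < n)%N -> a k = b k) -> cantor_sum r a n = cantor_sum r b n.
Proof. by move=> ab; apply: eq_bigr => k _; rewrite ab. Qed.

Lemma cantor_point_dist_le a b n : (forall k, (k < n)%N -> a k = b k) ->
  `|cantor_point r a - cantor_point r b| <= r ^+ n.
Proof.
move=> ab; rewrite ler_norml.
have /andP[] := cantor_point_itv a n; have /andP[] := cantor_point_itv b n.
by rewrite (eq_cantor_sum _ _ _ ab) => *; apply/andP; split; lra.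
Qed.

(** The digits at n separate the points by (1 - r) r^n and the tails give back at most r^(n+1); what
    is left is (1 - 2r) r^n. *)
Lemma cantor_point_dist_ge a b n : r <= 1 / 4 ->
  (forall k, (k < n)%N -> a k = b k) -> a n != b n ->
  r ^+ n / 2 <= `|cantor_point r a - cantor_point r b|.
Proof.
move=> r4 ab abn.
have /andP[] := cantor_point_itv a n.+1; have /andP[] := cantor_point_itv b n.+1.
rewrite !cantor_sumS (eq_cantor_sum _ _ _ ab) exprS.
have rn : r * r ^+ n <= 1 / 4 * r ^+ n by apply: ler_wpM2r => //; exact: exprn_ge0.
move: abn rn; case: (a n); case: (b n) => //= _; set q := r ^+ n => rn *.
  by rewrite ler_normr; apply/orP; left; lra.
by rewrite ler_normr; apply/orP; right; lra.
Qed.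

End CantorPoint.

(** * Binary expansions *)

Definition dyadic_floor {R : realType} (t : R) (n : nat) : nat :=
  Num.truncn (2 ^+ n * t).

Definition binary_digit {R : realType} (t : R) (k : nat) : bool :=
  odd (dyadic_floor t k.+1).

Section BinaryDigits.
Context {R : realType}.
Implicit Types s t : R.

Lemma dyadic_floor_itv t n : 0 <= t ->
  (dyadic_floor t n)%:R <= 2 ^+ n * t < (dyadic_floor t n).+1%:R.
Proof. by move=> t0; apply: truncn_itv; rewrite mulr_ge0. Qed.

Lemma dyadic_floorS_half t n : 0 <= t ->
  (dyadic_floor t n.+1)./2 = dyadic_floor t n.
Proof.
move=> t0; have := dyadic_floor_itv t n.+1 t0; set u := dyadic_floor _ _ => hu.
apply/esym/truncn_def; move: hu; rewrite exprS.
have /(congr1 (fun k : nat => k%:R : R)) := odd_double_half u.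
rewrite -!natr1 natrD -muln2 natrM => hE.
have : (odd u)%:R <= 1 :> R by case: (odd u).
have : 0 <= (odd u)%:R :> R by case: (odd u).
by move=> o0 o1 /andP[h1 h2]; apply/andP; split; lra.
Qed.

Lemma dyadic_floorS t n : 0 <= t ->
  dyadic_floor t n.+1 = (binary_digit t n + (dyadic_floor t n).*2)%N.
Proof. by move=> t0; rewrite -[in RHS]dyadic_floorS_half// odd_double_half. Qed.

Lemma eq_dyadic_floor_digit s t n k : 0 <= s -> 0 <= t ->
  dyadic_floor s n = dyadic_floor t n -> (k < n)%N ->
  binary_digit s k = binary_digit t k.
Proof.
move=> s0 t0; elim: n => // n IH e; rewrite ltnS leq_eqVlt => /orP[/eqP->|].
  by rewrite /binary_digit e.
by apply: IH; rewrite -(dyadic_floorS_half s)// -(dyadic_floorS_half t)// e.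
Qed.

Lemma eq_digit_dyadic_floor s t n : 0 <= s < 1 -> 0 <= t < 1 ->
  (forall k, (k < n)%N -> binary_digit s k = binary_digit t k) ->
  dyadic_floor s n = dyadic_floor t n.
Proof.
move=> /andP[s0 s1] /andP[t0 t1]; elim: n => [_|n IH e].
  by rewrite /dyadic_floor !mul1r !(@truncn_def _ _ 0) ?s0 ?t0.
by rewrite !dyadic_floorS// e// IH// => k kn; apply: e; rewrite ltnS ltnW.
Qed.

Lemma eq_dyadic_floor_dist s t n : 0 <= s -> 0 <= t ->
  dyadic_floor s n = dyadic_floor t n -> `|s - t| <= 2^-1 ^+ n.
Proof.
move=> s0 t0 e; have := dyadic_floor_itv s n s0; have := dyadic_floor_itv t n t0.
rewrite e -natr1 => /andP[h1 h2] /andP[h3 h4].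
rewrite exprVn -[X in _ <= X]mul1r ler_pdivlMr ?exprn_gt0//.
rewrite -[X in _ * X]ger0_norm ?exprn_ge0// -normrM mulrC mulrBr ler_norml.
by apply/andP; split; lra.
Qed.

(** If all digits agreed, s and t would share a dyadic interval of length 2^-n for every n. *)
Lemma digit_neq s t : 0 <= s < 1 -> 0 <= t < 1 -> s != t ->
  exists n, (forall k, (k < n)%N -> binary_digit s k = binary_digit t k) /\
    binary_digit s n != binary_digit t n.
Proof.
move=> s01 t01 st.
have [kP|ne] := pselect (exists k, binary_digit s k != binary_digit t k).
  exists (ex_minn kP); case: ex_minnP => n nP nmin; split=> // j jn.
  by apply/eqP/negPn/negP => /nmin; rewrite leqNgt jn.
exfalso; move: (st); rewrite -subr_eq0 -normr_gt0 => d0.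
have hn n : `|s - t| <= 2^-1 ^+ n.
  apply: eq_dyadic_floor_dist; [by case/andP: s01|by case/andP: t01|].
  apply: eq_digit_dyadic_floor => // k _; apply/eqP/negPn/negP => h.
  by apply: ne; exists k.
have q01 : (0 <= (2^-1 : R)) && ((2^-1 : R) < 1).
  by rewrite invr_ge0 invf_lt1 ?ltr1n ?ler0n.
have [N _ /(_ N (leqnn N))] := near_expr_lt _ _ _ q01 d0.
by rewrite /= ltNge hn.
Qed.

End BinaryDigits.

(* Only the binary expansions of t in [0, 1) are used as digit sequences: those
   ending in 1s are left out, so the set is not closed, but each of its points
   comes with a canonical t. *)
Definition cantor_set {R : realType} (r delta : R) : set R :=
  [set delta * cantor_point r (binary_digit t) | t in [set t : R | 0 <= t < 1]].

(** * Diameters and Hausdorff measure *)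

Section HausdorffMeasure.
Context {R : realType}.
Implicit Types (A E : set R) (s d : R).

Lemma hausdorff_gauge_ge0 s A : (0 <= hausdorff_gauge s A)%E.
Proof. by rewrite /hausdorff_gauge; case: ifP => // _; exact: poweR_ge0. Qed.

Lemma le_diam A x y : A x -> A y -> (`|x - y|%:E <= diam A)%E.
Proof. by move=> Ax Ay; apply: ereal_sup_ubound; exists (x, y). Qed.

Lemma diam_le A d : (forall x y, A x -> A y -> `|x - y| <= d) ->
  (diam A <= d%:E)%E.
Proof.
move=> h; apply: ge_ereal_sup => _ [[x y] [/= Ax Ay] <-].
by rewrite lee_fin; exact: h.
Qed.

(** A point of A excludes the value -oo and the bound excludes +oo, so that gauges reduce to real
    powers. *)
Lemma diam_fin A d : A !=set0 -> (diam A <= d%:E)%E ->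
  exists2 e : R, 0 <= e <= d & diam A = e%:E.
Proof.
move=> [x Ax]; have := le_diam _ _ _ Ax Ax; rewrite subrr normr0.
case: (diam A) => [e| |] //; rewrite !lee_fin => e0 ed.
by exists e => //; rewrite e0.
Qed.

Lemma hausdorff_measure_ge0 s E : (0 <= hausdorff_measure s E)%E.
Proof.
apply: le_ereal_sup_tmp; exists (hausdorff_premeasure s 1 E).
  by exists 1 => //=; exact: ltr01.
apply/ereal_infP => _ [F _ <-].
by apply: nneseries_ge0 => n _ _; exact: hausdorff_gauge_ge0.
Qed.

End HausdorffMeasure.

(** * Dimension of the Cantor set *)

Section CantorDimension.
Context {R : realType} (r delta : R).
Hypotheses (r_gt0 : 0 < r) (r_le : r <= 1 / 4) (d_gt0 : 0 < delta) (d_le1 : delta <= 1).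

(** The similarity dimension, that is, the root of 2 r^c = 1. *)
Let c : R := - ln 2 / ln r.

Lemma ratio_lt1 : r < 1.
Proof. by apply: le_lt_trans r_le _; rewrite ltr_pdivrMr// mul1r ltr1n. Qed.

Lemma ln_ratio_lt0 : ln r < 0.
Proof. by apply: ln_lt0; rewrite r_gt0 ratio_lt1. Qed.

Lemma cantor_dim_gt0 : 0 < c.
Proof.
by rewrite /c mulNr oppr_gt0 pmulr_rlt0 ?invr_lt0 ?ln_ratio_lt0// ln_gt0// ltr1n.
Qed.

Lemma powR_cantor_dim : r `^ c = 2^-1.
Proof.
rewrite /powR gt_eqF// /c divfK ?lt_eqF ?ln_ratio_lt0//.
by rewrite expRN lnK// posrE.
Qed.

(* The inverse of the coding map is c-Hoelder; Lebesgue measure on the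
   parameters t then plays the role of the Cantor measure. *)
Lemma cantor_set_expansion s t : 0 <= s < 1 -> 0 <= t < 1 ->
  `|s - t| <= (2 / delta) `^ c *
    `|delta * cantor_point r (binary_digit s) -
      delta * cantor_point r (binary_digit t)| `^ c.
Proof.
move=> s01 t01; have [->|st] := eqVneq s t.
  by rewrite subrr normr0 mulr_ge0 ?powR_ge0.
have [n [eqn neqn]] := digit_neq s t s01 t01 st.
rewrite -powRM ?divr_ge0 ?(ltW d_gt0)//.
rewrite -mulrBr normrM gtr0_norm// mulrA divfK ?gt_eqF//.
have h := cantor_point_dist_ge r (ltW r_gt0) (ltW ratio_lt1) _ _ _ r_le eqn neqn.
(* With n the first differing digit, |s - t| is at most 2^-n = (r^n)^c, and r^n is at most twice the
   distance of the unscaled points. *)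
apply: (@le_trans _ _ ((r ^+ n) `^ c)); last first.
  apply: ge0_ler_powR; rewrite ?nnegrE ?(ltW cantor_dim_gt0) ?exprn_ge0
    ?mulr_ge0 ?(ltW r_gt0)//.
  by move: h; set z := `|_|; lra.
rewrite -powR_mulrn ?(ltW r_gt0)// -powRrM mulrC powRrM powR_cantor_dim.
rewrite powR_mulrn ?invr_ge0//.
have [[s0 _] [t0 _]] := (andP s01, andP t01).
by apply: eq_dyadic_floor_dist => //; exact: eq_digit_dyadic_floor.
Qed.

(** Mass distribution principle: a cover of the set pulls back to a cover of [0, 1), whose k-th
    piece lies in an interval of length at most 2M times the gauge of [F k]. As the lengths add up
    to at least 1, the cover costs at least 1 / (2M). *)
Lemma cantor_set_measure_gt0 s : 0 <= s <= c ->
  (0 < hausdorff_measure s (cantor_set r delta))%E.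
Proof.
move=> /andP[s0 sc]; set E := cantor_set _ _.
set M := (2 / delta) `^ c.
have M0 : 0 < M by rewrite powR_gt0 ?divr_gt0.
(* Scale 1 suffices: it makes every diameter D at most 1, whence D^c <= D^s. *)
suff : ((2 * M)^-1%:E <= hausdorff_premeasure s 1 E)%E.
  move=> h; apply: (@lt_le_trans _ _ (2 * M)^-1%:E).
    by rewrite lte_fin invr_gt0 mulr_gt0.
  by apply: (le_trans h); apply: ereal_sup_ubound; exists 1 => //=; exact: ltr01.
apply/ereal_infP => _ [F [EF dF] <-].
pose psi (t : R) := delta * cantor_point r (binary_digit t).
pose T k := [set t : R | 0 <= t < 1 /\ F k (psi t)].
have I_ k : exists I : set R, [/\ measurable I, T k `<=` I &
   (lebesgue_measure I <= (2 * M)%:E * hausdorff_gauge s (F k))%E].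
  have [T0|/set0P[t0 [t01 Ft0]]] := eqVneq (T k) set0.
    exists set0; rewrite T0 measure0; split=> //.
    by rewrite mule_ge0// ?hausdorff_gauge_ge0// lee_fin mulr_ge0// ltW.
  have Fk0 : F k !=set0 by exists (psi t0).
  have [D /andP[D0 D1] DE] := diam_fin _ _ Fk0 (dF k).
  (* [F k] is arbitrary, so [T k] need not be measurable; an interval around one of its points
     replaces it. *)
  exists `[t0 - M * D `^ c, t0 + M * D `^ c]%classic; split.
  - exact: measurable_itv.
  - move=> t [tt Ft] /=; rewrite in_itv/=.
    have : `|t - t0| <= M * D `^ c.
      apply: (le_trans (cantor_set_expansion _ _ tt t01)).
      apply: ler_wpM2l; first exact: ltW.
      apply: ge0_ler_powR; rewrite ?nnegrE ?(ltW cantor_dim_gt0)//.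
      by rewrite -lee_fin -DE; exact: le_diam.
    by rewrite ler_norml => /andP[h1 h2]; apply/andP; split; lra.
  - have MD : 0 <= M * D `^ c by rewrite mulr_ge0 ?powR_ge0// ltW.
    apply: (@le_trans _ _ (2 * M * D `^ c)%:E).
      rewrite lebesgue_measure_itv/=; case: ifPn => _; last first.
        by rewrite lee_fin -mulrA mulr_ge0.
      by rewrite lee_fin; lra.
    rewrite EFinM lee_pmul2l ?lte_fin ?mulr_gt0//.
    rewrite /hausdorff_gauge; have /set0P/negbTE -> := Fk0.
    rewrite DE poweR_EFin lee_fin.
    (* Monotonicity in the exponent needs a positive base; for D = 0 the left side vanishes because
       c > 0. *)
    have [->|Dn0] := eqVneq D 0.
      by rewrite powR0 ?gt_eqF ?cantor_dim_gt0// powR_ge0.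
    by apply: ger_powR => //; rewrite lt_neqAle eq_sym Dn0 D0 D1.
have [I IP] := choice I_.
have mI k : measurable (I k) by case: (IP k).
have cov : `[0, 1[%classic `<=` \bigcup_k I k.
  move=> t /=; rewrite in_itv/= => t01.
  have [k _ Fk] : (\bigcup_k F k) (psi t) by apply: EF; exists t.
  by exists k => //; case: (IP k) => _ TI _; apply: TI.
have m01 : measurable (`[0, 1[%classic : set R) by exact: measurable_itv.
have h : (lebesgue_measure (`[0%R : R, 1%R[%classic) <=
    \sum_(0 <= k <oo) lebesgue_measure (I k))%E.
  exact: measure_sigma_subadditive.
rewrite lebesgue_measure_itv/= lte_fin ltr01 sube0 in h.
have : (1 <= \sum_(0 <= k <oo) (2 * M)%:E * hausdorff_gauge s (F k))%E.
  by apply: (le_trans h); apply: lee_nneseries => // n _; case: (IP n).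
rewrite nneseriesZl; last by move=> *; exact: hausdorff_gauge_ge0.
by rewrite -lee_pdivrMl ?mulr_gt0// mule1.
Qed.

(** The 2^n pieces of level n have diameter at most r^n and cost at most (2 r^s)^n in all, which
    tends to 0 since 2 r^s < 2 r^c = 1. *)
Lemma cantor_set_measure_eq0 s : c < s ->
  hausdorff_measure s (cantor_set r delta) = 0%E.
Proof.
move=> cs; have s0 : 0 < s := lt_trans cantor_dim_gt0 cs.
apply/eqP; rewrite eq_le hausdorff_measure_ge0 andbT.
apply/ereal_supP => _ [d /= d0 <-]; apply/lee_addgt0Pr => e e0; rewrite add0e.
have rs1 : 0 <= 2 * r `^ s < 1.
  rewrite mulr_ge0 ?powR_ge0//= mulrC -ltr_pdivlMr// mul1r -powR_cantor_dim.
  by rewrite /powR gt_eqF// ltr_expR ltr_nM2r ?ln_ratio_lt0.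
have r1 : 0 <= r < 1 by rewrite ltW ?ratio_lt1.
have [n [nd ne]] : exists n, r ^+ n < d /\ (2 * r `^ s) ^+ n < e.
  have [N _ hN] := filterI (near_expr_lt _ _ _ r1 d0) (near_expr_lt _ _ _ rs1 e0).
  by exists N; apply: hN => /=.
pose psi (t : R) := delta * cantor_point r (binary_digit t).
(* The integer k encodes the first n digits, so [F k] is empty from k = 2^n on. *)
pose F k := [set psi t | t in [set t : R | 0 <= t < 1 /\ dyadic_floor t n = k]].
have dF k : (diam (F k) <= (r ^+ n)%:E)%E.
  apply: diam_le => _ _ [t [/andP[t0 t1] tk] <-] [u [/andP[u0 u1] uk] <-].
  rewrite -mulrBr normrM gtr0_norm// -[X in _ <= X]mul1r ler_pM ?(ltW d_gt0)//.
  apply: cantor_point_dist_le; [exact: ltW|exact: ltW ratio_lt1|] => k' k'n.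
  by apply: eq_dyadic_floor_digit k'n => //; rewrite tk uk.
have F0 k : (2 ^ n <= k)%N -> F k = set0.
  move=> nk; rewrite -subset0 => y [t [/andP[t0 t1] tk] _].
  have /andP[h _] := dyadic_floor_itv t n t0; move: h; rewrite leNgt => /negP; apply.
  rewrite tk (@lt_le_trans _ _ (2 ^+ n))//; last by rewrite -natrX ler_nat.
  by rewrite -[X in _ < X]mulr1 ltr_pM2l ?exprn_gt0.
apply: ge_ereal_inf; exists (\sum_(0 <= k <oo) hausdorff_gauge s (F k))%E.
  exists F => //; split => [_ [t t01 <-]|k].
    by exists (dyadic_floor t n) => //; exists t.
  by apply: (le_trans (dF k)); rewrite lee_fin ltW.
rewrite (nneseries_split 0 (2 ^ n)); last by move=> *; exact: hausdorff_gauge_ge0.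
rewrite add0n eseries0 ?adde0; last first.
  by move=> k nk _; rewrite /hausdorff_gauge F0// eqxx.
apply: (@le_trans _ _ (\sum_(0 <= k < 2 ^ n) ((r ^+ n) `^ s)%:E)%E).
  apply: lee_sum => k _; rewrite /hausdorff_gauge; case: ifPn => [_|/set0P Fk0].
    by rewrite lee_fin powR_ge0.
  have [D /andP[D0 D1] ->] := diam_fin _ _ Fk0 (dF k).
  rewrite poweR_EFin lee_fin; apply: ge0_ler_powR => //; first exact: ltW.
  by rewrite nnegrE exprn_ge0// ltW.
rewrite sumEFin lee_fin big_const_nat subn0 iter_addr_0.
apply: le_trans (ltW ne); rewrite exprMn -[X in X <= _]mulr_natl natrX.
by rewrite -[r ^+ n]powR_mulrn ?(ltW r_gt0)// -powRrM [n%:R * s]mulrC powRrM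
  powR_mulrn ?powR_ge0.
Qed.

Lemma hausdorff_dim_cantor_set : hausdorff_dim (cantor_set r delta) = c%:E.
Proof.
apply/eqP; rewrite eq_le; apply/andP; split.
  apply/lee_addgt0Pr => e e0; apply: ereal_inf_lbound; exists (c + e) => //.
  split; first by have := cantor_dim_gt0; lra.
  by apply: cantor_set_measure_eq0; lra.
apply/ereal_infP => _ [s [s0 sE] <-]; rewrite lee_fin leNgt; apply/negP => sc.
by have := cantor_set_measure_gt0 s; rewrite sE ltxx s0 ltW// => /(_ isT).
Qed.

End CantorDimension.

Lemma cantor_set_sub_itv {R : realType} (r delta : R) :
  0 <= r <= 1 -> 0 <= delta <= 1 -> cantor_set r delta `<=` `[0, 1].
Proof.
move=> /andP[r0 r1] /andP[d0 d1] _ [t _ <-]; rewrite /= in_itv/=.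
have := cantor_point_itv r r0 r1 (binary_digit t) 0.
rewrite /cantor_sum big_ord0 add0r expr0 => /andP[p0 p1].
by rewrite mulr_ge0//= mulr_ile1.
Qed.

(** * Lower bound for the linear form *)

Section LinearForm.
Context {R : realType} (v : nat) (alpha : 'I_v -> R).

Lemma proper_subsum_bound :
  (forall C : {set 'I_v}, C != finset.set0 -> C \proper [set: 'I_v]%SET ->
    \sum_(j in C) alpha j != 0) ->
  exists2 m : R, 0 < m & forall C : {set 'I_v}, C != finset.set0 ->
    C \proper [set: 'I_v]%SET -> m <= `|\sum_(j in C) alpha j|.
Proof.
move=> h; pose P (C : {set 'I_v}) := (C != finset.set0) && (C \proper [set: 'I_v]%SET).
(* A minimum over finitely many subsets; including 1 can only lower it and keeps it positive. *)
exists (\big[Order.min/1]_(C | P C) `|\sum_(j in C) alpha j|).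
  by apply: lt_bigmin => // C /andP[C0 CT]; rewrite normr_gt0 h.
by move=> C C0 CT; apply: bigmin_le_cond; rewrite /P C0.
Qed.

Lemma cantor_linear_form_ge (r m : R) (a : 'I_v -> nat -> bool) (n : nat) (i j : 'I_v) :
  0 <= r <= 1 -> \sum_k alpha k = 0 ->
  (forall C : {set 'I_v}, C != finset.set0 -> C \proper [set: 'I_v]%SET ->
    m <= `|\sum_(k in C) alpha k|) ->
  (forall k l p, (p < n)%N -> a k p = a l p) -> a i n != a j n ->
  r ^+ n * ((1 - r) * m - r * \sum_k `|alpha k|)
    <= `|\sum_k alpha k * cantor_point r (a k)|.
Proof.
move=> /andP[r0 r1] sum0 hm eqa neqa.
have rn0 : 0 <= r ^+ n by exact: exprn_ge0.
pose C := [set k | a k n]%SET.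
(* The tail beyond digit n, which lies in [0, r^(n+1)]. *)
pose th k := cantor_point r (a k) - cantor_sum r (a k) n.+1.
have thE : `|\sum_k alpha k * th k| <= r ^+ n * r * \sum_k `|alpha k|.
  apply: (le_trans (ler_norm_sum _ _ _)); rewrite mulr_sumr.
  apply: ler_sum => k _; rewrite normrM mulrC -exprSr ler_wpM2r//.
  have /andP[h1 h2] := cantor_point_itv r r0 r1 (a k) n.+1.
  by rewrite /th ler_norml; apply/andP; split; have := exprn_ge0 n.+1 r0; lra.
have splitE : \sum_k alpha k * cantor_point r (a k) =
    (1 - r) * r ^+ n * \sum_(k in C) alpha k + \sum_k alpha k * th k.
  rewrite [\sum_(k in C) _]big_mkcond mulr_sumr -big_split/=.
  transitivity (\sum_k alpha k * cantor_sum r (a i) n +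
    \sum_k (alpha k * ((a k n)%:R * ((1 - r) * r ^+ n)) + alpha k * th k)).
    rewrite -big_split; apply: eq_bigr => k _ /=.
    rewrite /th cantor_sumS (eq_cantor_sum r (a k) (a i)); first by ring.
    by move=> p pn; exact: eqa.
  rewrite -mulr_suml sum0 mul0r add0r; apply: eq_bigr => k _.
  by rewrite inE; case: (a k n) => /=; ring.
(* Exactly one of i and j belongs to [C], which is therefore nonempty and proper. *)
have mC : m <= `|\sum_(k in C) alpha k|.
  apply: hm; last first.
    rewrite properT; apply/negP => /eqP CT.
    have : i \in C by rewrite CT inE.
    have : j \in C by rewrite CT inE.
    by rewrite !inE => aj ai; move: neqa; rewrite aj ai.
  have /orP[ai|aj] : a i n || a j n by move: neqa; case: (a i n); case: (a j n).
    by apply/set0Pn; exists i; rewrite inE.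
  by apply/set0Pn; exists j; rewrite inE.
have mC' : (1 - r) * r ^+ n * m <= `|(1 - r) * r ^+ n * \sum_(k in C) alpha k|.
  have c0 : 0 <= (1 - r) * r ^+ n by rewrite mulr_ge0 ?subr_ge0.
  by rewrite normrM ger0_norm// ler_wpM2l.
rewrite splitE; apply: le_trans (lerB_normD _ _); rewrite -lerN2 in thE.
by apply: le_trans (lerD mC' thE); rewrite le_eqVlt; apply/orP; left; apply/eqP; ring.
Qed.

End LinearForm.

(** At the first level n where the digits are not all equal, the linear form exceeds delta r^n (K v
    delta), while |g| is at most K v (delta r^n)^2, which is no larger as r^n <= 1. *)
Lemma cantor_set_no_solution {R : realType} (v : nat) (i0 : 'I_v)
    (alpha : 'I_v -> R) (K r delta m : R) (x : 'I_v -> R) (g : R) :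
  0 < K -> 0 < r <= 1 -> 0 < delta -> \sum_k alpha k = 0 ->
  (forall C : {set 'I_v}, C != finset.set0 -> C \proper [set: 'I_v]%SET ->
    m <= `|\sum_(k in C) alpha k|) ->
  K * v%:R * delta < (1 - r) * m - r * \sum_k `|alpha k| ->
  (forall j, cantor_set r delta (x j)) -> ~ (forall i j, x i = x j) ->
  `|g| <= K * \sum_(j | j != i0) (x j - x i0) ^+ 2 ->
  \sum_j alpha j * x j + g != 0.
Proof.
move=> K0 /andP[r0 r1] d0 sum0 hm Kd xE xne gle.
have xE' j : exists u : R, x j = delta * cantor_point r (binary_digit u).
  by case: (xE j) => u _ <-; exists u.
have [t tP] := choice xE'.
pose a j := binary_digit (t j).
have xa j : x j = delta * cantor_point r (a j) by exact: tP.
have [n [/existsP[i /existsP[j aij]] an]] : exists n,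
    [exists i, exists j, a i n != a j n] /\
    forall p, (p < n)%N -> forall i j, a i p = a j p.
  have nP : exists n, [exists i, exists j, a i n != a j n].
    apply: contrapT => ne; apply: xne => i j; rewrite !xa.
    congr (_ * cantor_point r _); apply/funext => p; apply/eqP/negPn/negP => h.
    by apply: ne; exists p; apply/existsP; exists i; apply/existsP; exists j.
  exists (ex_minn nP); case: ex_minnP => n nn nmin; split=> // p pn i j.
  apply/eqP/negPn/negP => h; have := nmin p; rewrite leqNgt pn => /(_ _)/notF; apply.
  by apply/existsP; exists i; apply/existsP; exists j.
have rn0 : 0 < r ^+ n by exact: exprn_gt0.
have rn1 : r ^+ n <= 1 by rewrite exprn_ile1 ?(ltW r0).
have := cantor_linear_form_ge v alpha r m a n i j _ sum0 hm _ aij.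
rewrite (ltW r0) r1 => /(_ isT (fun k l p pn => an p pn k l)) lin.
have dist k : `|x k - x i0| <= delta * r ^+ n.
  rewrite !xa -mulrBr normrM gtr0_norm// ler_pM2l//.
  by apply: cantor_point_dist_le; [exact: ltW|exact: r1|move=> p /an].
have gle' : `|g| <= K * v%:R * (delta * r ^+ n) ^+ 2.
  (* The index [i0] is put back, giving v terms of at most (delta r^n)^2 each. *)
  apply: (le_trans gle); rewrite -mulrA ler_pM2l// big_mkcond/=.
  rewrite -[v in v%:R]card_ord mulr_natl -sumr_const; apply: ler_sum => k _.
  case: ifP => _; last exact: sqr_ge0.
  by rewrite -real_normK ?num_real// lerXn2r ?nnegrE ?mulr_ge0 ?(ltW d0) ?(ltW rn0).
apply/negP => /eqP/(canRL (addrK _)); rewrite sub0r => /(congr1 Num.norm).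
under eq_bigr do rewrite xa mulrCA.
rewrite -mulr_sumr normrM normrN gtr0_norm// => E.
suff : delta * r ^+ n * (K * v%:R * delta) < K * v%:R * (delta * r ^+ n) ^+ 2.
  have -> : K * v%:R * (delta * r ^+ n) ^+ 2 =
    delta * r ^+ n * (K * v%:R * delta) * r ^+ n by ring.
  by rewrite ltNge ler_piMr// !mulr_ge0// ?(ltW rn0) ?(ltW d0) ?(ltW K0).
apply: lt_le_trans gle'; rewrite -E -mulrA ltr_pM2l//.
by apply: lt_le_trans lin; rewrite ltr_pM2l.
Qed.

(** * Choice of the ratio and the scale *)

Theorem theorem1p3 (R : realType) (v : nat) (hv : (2 <= v)%N)
    (alpha : 'rV[R]_v)
    (hproper : forall C : {set 'I_v}, C != finset.set0 ->
      C \proper [set: 'I_v]%SET -> \sum_(j in C) alpha ord0 j != 0)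
    (hsum : \sum_(j < v) alpha ord0 j = 0) :
  exists c : R, 0 < c /\
    forall K : R, 0 < K ->
    exists E : set R,
      [/\ E `<=` `[0, 1],
          hausdorff_dim E = c%:E &
          forall f G : 'rV[R]_v -> R,
            Ck_on 2 (unit_cube R v) f ->
            (forall x, unit_cube R v x ->
              f x = \sum_(j < v) alpha ord0 j * x ord0 j + G x) ->
            (forall x, unit_cube R v x ->
              `|G x| <= K * \sum_(j < v | (0 < j)%N)
                (x ord0 j - x ord0 (Ordinal (ltnW hv))) ^+ 2) ->
            ~ exists x : 'rV[R]_v,
                [/\ forall j, E (x ord0 j),
                    ~ (forall i j, x ord0 i = x ord0 j) &
                    f x = 0]].
Proof.
pose i0 := Ordinal (ltnW hv); pose al j := alpha ord0 j.
have [m m0 hm] := proper_subsum_bound v al hproper.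
pose A := \sum_j `|al j|.
have A0 : 0 <= A by apply: sumr_ge0 => j _; exact: normr_ge0.
(* This makes (1 - r) m - r A = m - r (m + A) equal to 3m / 4, and r <= 1/4 because A >= 0. *)
pose r := m / (4 * (m + A)).
have rE : r * (m + A) = m / 4 by rewrite /r; field; lra.
have r0 : 0 < r by rewrite divr_gt0// mulr_gt0//; lra.
have r4 : r <= 1 / 4 by rewrite ler_pdivrMr; nra.
have r1 : r <= 1 by lra.
exists (- ln 2 / ln r); split; first exact: cantor_dim_gt0.
(* Then K v delta < m / 8, well below 3m / 4; the summand m in the denominator ensures delta <=
   1. *)
move=> K K0; pose delta := m / (m + 8 * (K * v%:R)).
have Kv : 0 <= K * v%:R by rewrite mulr_ge0 ?(ltW K0).
have dE : delta * (m + 8 * (K * v%:R)) = m by rewrite /delta; field; lra.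
have d0 : 0 < delta by rewrite divr_gt0//; lra.
have d1 : delta <= 1 by rewrite ler_pdivrMr; lra.
have Kd : K * v%:R * delta < (1 - r) * m - r * A.
  have := mulr_gt0 d0 m0; lra.
exists (cantor_set r delta); split.
- by apply: cantor_set_sub_itv; rewrite ltW.
- exact: hausdorff_dim_cantor_set.
move=> f G _ fE GE [x [xE xne fx0]].
have xcube : unit_cube R v x.
  move=> j; have : `[0, 1]%classic (x ord0 j).
    by apply: cantor_set_sub_itv (xE j); rewrite ltW.
  by rewrite /= in_itv.
have := GE x xcube; rewrite (eq_bigl (fun j => j != i0)); last first.
  by move=> j; rewrite lt0n -val_eqE.
rewrite -/i0 => Gx.
have r01 : 0 < r <= 1 by rewrite r0.
have := cantor_set_no_solution v i0 al K r delta m _ _ K0 r01 d0 hsum hm Kd xE xne Gx.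
by rewrite -fE// fx0 eqxx.
Qed.
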